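(* Let $q$ be a prime power, $v=q^2+q+1$, let $D\subseteq\mathbb{Z}/v\mathbb{Z}$ be a perfect difference set with $qD=D$, let $m\in\{q,q^2\}$, and let $$\mathscr{T}=\{(j,\,j+d,\,j+d+md): j\in\mathbb{Z}/v\mathbb{Z},\ d\in D\}$$ be the associated triangle presentation. Let $\Gamma_{\mathscr{T}}$, $\langle p\rangle$, $\Gamma''_{\mathscr{A}}\le\Gamma_{\mathscr{T}}\rtimes\langle p\rangle$, $\phi:\Gamma''_{\mathscr{A}}\to\mathbb{Z}/v\mathbb{Z}$, $\psi:\Gamma_{\mathscr{T}}\to\mathbb{Z}/3\mathbb{Z}$ and $\Gamma_{\mathscr{R}(\mathscr{T})}\le\Gamma_{\mathscr{T}}$ be as defined in the context. Then, as subgroups of $\Gamma_{\mathscr{T}}\rtimes\langle p\rangle$, $$\ker\phi=\ker\psi=\Gamma_{\mathscr{R}(\mathscr{T})}.$$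
   Context: Perfect difference set: a subset $D\subseteq\mathbb{Z}/v\mathbb{Z}$, $v=q^2+q+1$, with $|D|=q+1$, such that every nonzero element of $\mathbb{Z}/v\mathbb{Z}$ occurs exactly once among the differences $d-d'$ with $d,d'\in D$. The associated projective plane has points $\mathbb{Z}/v\mathbb{Z}$ and lines $j+D$; $\mathscr{T}$ is a triangle presentation compatible with $\alpha(j)=j+D$, meaning: for points $a,b$ there is $c$ with $(a,b,c)\in\mathscr{T}$ iff $b\in\alpha(a)$; $\mathscr{T}$ is closed under cyclic permutation of triples; and $c$ is determined by $(a,b)$. $\Gamma_{\mathscr{T}}=\langle a_0,\dots,a_{v-1} : a_ia_ja_k=1 \text{ for all }(i,j,k)\in\mathscr{T}\rangle$, with indices in $\mathbb{Z}/v\mathbb{Z}$. The permutation $p(i)=i+1$ of $\mathbb{Z}/v\mathbb{Z}$ has order $v$, preserves $\mathscr{T}$, and acts on $\Gamma_{\mathscr{T}}$ by $pa_ip^{-1}=a_{i+1}$; $\Gamma_{\mathscr{T}}\rtimes\langle p\rangle$ is the resulting semidirect product, where $\langle p\rangle$ is cyclic of order $v$. Fix $(i,j,k)\in\mathscr{T}$. The Singer cyclic lattice $\Gamma''_{\mathscr{A}}$ is the subgroup of $\Gamma_{\mathscr{T}}\rtimes\langle p\rangle$ generated by $\sigma_0=p$, $\sigma_1=a_ipa_i^{-1}$, $\sigma_2=a_k^{-1}pa_k$. These generate the stabilizers of the three vertices $e$, $a_i$, $a_k^{-1}$ of a chamber of the $\tilde A_2$ building whose $1$-skeleton is the Cayley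 graph of $\Gamma_{\mathscr{T}}$. $\phi:\Gamma''_{\mathscr{A}}\to\mathbb{Z}/v\mathbb{Z}$ is the homomorphism with $\phi(\sigma_0)=\phi(\sigma_1)=\phi(\sigma_2)=1$. $\psi:\Gamma_{\mathscr{T}}\to\mathbb{Z}/3\mathbb{Z}$ is the homomorphism with $\psi(a_i)=1$ for all $i$. $\Gamma_{\mathscr{R}(\mathscr{T})}$ is the subgroup of $\Gamma_{\mathscr{T}}$ generated by all $b_{i,j}=a_ia_j^{-1}$, $i\neq j$. *)

(* Defs.v *)
From HB Require Import structures.
From mathcomp Require Import all_boot all_order all_algebra all_fingroup.
From mathcomp Require Import boolp classical_sets.

Set Implicit Arguments.
Unset Strict Implicit.
Unset Printing Implicit Defensive.

Import GRing.Theory.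
Local Open Scope group_scope.
Local Open Scope classical_set_scope.

Definition is_subgroup (G : groupType) (H : set G) : Prop :=
  H 1 /\ (forall x y, H x -> H y -> H (x * y^-1)).

Definition generated (G : groupType) (A : set G) : set G :=
  smallest (@is_subgroup G) A.

Section Presentation.
Variable X : choiceType.

(* The letter [(x, false)] stands for x and [(x, true)] for its inverse. *)
Definition word := seq (X * bool).

Definition word_inv (w : word) : word := rev [seq (l.1, ~~ l.2) | l <- w].

Variable R : set word.

Inductive pres_eq : word -> word -> Prop :=
| pres_refl w : pres_eq w w
| pres_sym u w : pres_eq u w -> pres_eq w u
| pres_trans u w z : pres_eq u w -> pres_eq w z -> pres_eq u z
| pres_cancel x b u w : pres_eq (u ++ [:: (x, b); (x, ~~ b)] ++ w) (u ++ w)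
| pres_relator r u w : R r -> pres_eq (u ++ r ++ w) (u ++ w).

Definition pres_eqb (u w : word) : bool := `[< pres_eq u w >].

Lemma pres_eqb_refl : reflexive pres_eqb.
Proof. by move=> w; apply/asboolP; exact: pres_refl. Qed.

Lemma pres_eqb_sym : symmetric pres_eqb.
Proof. by move=> u w; apply/asboolP/asboolP; exact: pres_sym. Qed.

Lemma pres_eqb_trans : transitive pres_eqb.
Proof.
by move=> w u z /asboolP uw /asboolP wz; apply/asboolP; exact: pres_trans uw wz.
Qed.

Canonical pres_equiv := EquivRel pres_eqb pres_eqb_refl pres_eqb_sym pres_eqb_trans.

Definition presGroup : Type := {eq_quot pres_equiv}%qT.

HB.instance Definition _ := Choice.on presGroup.

Definition pclass (w : word) : presGroup := (\pi_({eq_quot pres_equiv}) w)%qT.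
Definition prepr (g : presGroup) : word := generic_quotient.repr (g : {eq_quot pres_equiv}%qT).

Lemma preprK g : pclass (prepr g) = g.
Proof. exact: reprK. Qed.

Lemma pclassP u w : pclass u = pclass w <-> pres_eq u w.
Proof. by split=> [/eqmodP/asboolP|] // uw; apply/eqmodP/asboolP. Qed.

Lemma prepr_class w : pres_eq (prepr (pclass w)) w.
Proof. by apply/pclassP; rewrite preprK. Qed.

Lemma pres_cat2 s t u w : pres_eq u w -> pres_eq (s ++ u ++ t) (s ++ w ++ t).
Proof.
elim=> [a|a b _|a b c _ ab _ bc|x b a c|r a c Rr].
- exact: pres_refl.
- exact: pres_sym.
- exact: pres_trans ab bc.
- by have := pres_cancel x b (s ++ a) (c ++ t); rewrite -!catA.
- by have := pres_relator (s ++ a) (c ++ t) Rr; rewrite -!catA.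
Qed.

Lemma pres_cat u u' w w' :
  pres_eq u u' -> pres_eq w w' -> pres_eq (u ++ w) (u' ++ w').
Proof.
move=> uu' ww'; apply: (@pres_trans _ (u' ++ w)).
  exact: (pres_cat2 [::] w uu').
by have := pres_cat2 u' [::] ww'; rewrite !cats0.
Qed.

Lemma word_invK : involutive word_inv.
Proof.
move=> w; rewrite /word_inv map_rev revK -map_comp -[RHS]map_id.
by apply: eq_map => -[x b] /=; rewrite negbK.
Qed.

Lemma pres_mulV w : pres_eq (w ++ word_inv w) [::].
Proof.
elim/last_ind: w => [|w [x b] IHw]; first exact: pres_refl.
apply: pres_trans IHw; rewrite /word_inv map_rcons rev_rcons -cats1 -catA /=.
exact: pres_cancel.
Qed.

Lemma pres_Vmul w : pres_eq (word_inv w ++ w) [::].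
Proof. by rewrite -{2}[w]word_invK; exact: pres_mulV. Qed.

Definition pmul (g h : presGroup) : presGroup := pclass (prepr g ++ prepr h).
Definition pinv (g : presGroup) : presGroup := pclass (word_inv (prepr g)).

Lemma pclass_cat u w : pclass (u ++ w) = pmul (pclass u) (pclass w).
Proof. by apply/pclassP/pres_sym; apply: pres_cat; exact: prepr_class. Qed.

Lemma pmulA : associative pmul.
Proof.
move=> a b c; rewrite -[a]preprK -[b]preprK -[c]preprK.
by rewrite -!pclass_cat catA.
Qed.

Lemma pmul1 : left_id (pclass [::]) pmul.
Proof. by move=> a; rewrite -[a]preprK -pclass_cat. Qed.

Lemma pmulr1 : right_id (pclass [::]) pmul.
Proof. by move=> a; rewrite -[a]preprK -pclass_cat cats0. Qed.

Lemma pmulV : left_inverse (pclass [::]) pinv pmul.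
Proof.
move=> a; rewrite -{2}[a]preprK -pclass_cat; apply/pclassP; exact: pres_Vmul.
Qed.

Lemma pmulrV : right_inverse (pclass [::]) pinv pmul.
Proof.
move=> a; rewrite -{1}[a]preprK -pclass_cat; apply/pclassP; exact: pres_mulV.
Qed.

HB.instance Definition _ :=
  isGroup.Build presGroup pmulA pmul1 pmulr1 pmulV pmulrV.

Definition pgen (x : X) : presGroup := pclass [:: (x, false)].

Lemma pclassM u w : pclass (u ++ w) = pclass u * pclass w.
Proof. exact: pclass_cat. Qed.

End Presentation.

Record gaction (H G : groupType) := GAction {
  gact :> H -> G -> G;
  gact1 : forall g, gact 1 g = g;
  gactM : forall h k g, gact (h * k) g = gact h (gact k g);
  gact_morph : forall h, {morph gact h : g g' / g * g'}
}.

(* The normal factor G comes first: the pair (g, h) stands for g * h, and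
   h g h^-1 = act h g. *)
Definition semidirect_type (H G : groupType) (act : gaction H G) : Type :=
  (G * H)%type.

HB.instance Definition _ (H G : groupType) (act : gaction H G) :=
  Choice.on (semidirect_type act).

Section Semidirect.
Variables (H G : groupType) (act : gaction H G).
Local Notation semidirect := (semidirect_type act).

Definition sd_mul (x y : semidirect) : semidirect :=
  (x.1 * act x.2 y.1, x.2 * y.2).
Definition sd_one : semidirect := (1, 1).
Definition sd_inv (x : semidirect) : semidirect :=
  (act x.2^-1 x.1^-1, x.2^-1).

Lemma gact_one h : act h 1 = 1.
Proof. by apply: (@mulgI _ (act h 1)); rewrite -gact_morph !mulg1. Qed.

Lemma sd_mulA : associative sd_mul.
Proof. by move=> x y z; rewrite /sd_mul /= gact_morph gactM !mulgA. Qed.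

Lemma sd_mul1 : left_id sd_one sd_mul.
Proof. by case=> g h; rewrite /sd_mul /= gact1 !mul1g. Qed.

Lemma sd_mulr1 : right_id sd_one sd_mul.
Proof. by case=> g h; rewrite /sd_mul /= gact_one !mulg1. Qed.

Lemma sd_mulV : left_inverse sd_one sd_inv sd_mul.
Proof.
by case=> g h; rewrite /sd_mul /sd_inv /= -gact_morph !mulVg gact_one.
Qed.

Lemma sd_mulrV : right_inverse sd_one sd_inv sd_mul.
Proof.
by case=> g h; rewrite /sd_mul /sd_inv /= -gactM !mulgV gact1 mulgV.
Qed.

HB.instance Definition _ :=
  isGroup.Build semidirect sd_mulA sd_mul1 sd_mulr1 sd_mulV sd_mulrV.

Definition sd_inl (g : G) : semidirect := (g, 1).
Definition sd_inr (h : H) : semidirect := (1, h).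

End Semidirect.

Definition perfect_difference_set (q v : nat) (D : {set 'Z_v}) : Prop :=
  #|D| = q.+1 /\
  forall x : 'Z_v, x != 0%R ->
    #|[set dd in finset.setX D D | (dd.1 - dd.2 == x)%R]%SET| = 1%N.

Section SingerCyclic.
Variables (v : nat) (D : {set 'Z_v}) (m : nat).

Definition triples : {set 'Z_v * 'Z_v * 'Z_v} :=
  [set (j, (j + d)%R, (j + d + m%:R * d)%R) | j : 'Z_v, d : 'Z_v in D]%SET.

Definition triangle_relators : set (word 'Z_v) :=
  [set w | exists i j k, (i, j, k) \in triples /\
     w = [:: (i, false); (j, false); (k, false)]].

Definition GammaT : groupType := presGroup triangle_relators.

Definition a_ (i : 'Z_v) : GammaT := pgen triangle_relators i.

Definition shift : {perm 'Z_v} := perm (@addIr _ (1%R : 'Z_v)).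

Definition cyc_shift : groupType := subg_of <[shift]>.

Lemma shiftX n i : (shift ^+ n) i = (i + n%:R)%R.
Proof.
elim: n => [|n IHn]; first by rewrite expg0 perm1 addr0.
by rewrite expgSr permM IHn permE -addrA -natr1.
Qed.

Lemma cyc_shiftE (s : cyc_shift) i : sgval s i = (i + sgval s 0)%R.
Proof.
by case: s => s /= /cycleP[n ->]; rewrite !shiftX add0r.
Qed.

Lemma triples_shift (s : cyc_shift) i j k :
  (i, j, k) \in triples -> (sgval s i, sgval s j, sgval s k) \in triples.
Proof.
case/imset2P=> x d _ Dd [-> -> ->]; apply/imset2P.
exists (sgval s x) d => //.
rewrite !(cyc_shiftE s x) !(cyc_shiftE s (x + d)%R) (cyc_shiftE s (x + d + _)%R).
by congr (_, _, _); rewrite addrAC //; congr (_ + _)%R; rewrite addrAC.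
Qed.

Definition word_map (f : 'Z_v -> 'Z_v) (w : word 'Z_v) : word 'Z_v :=
  [seq (f l.1, l.2) | l <- w].

Lemma word_map_eq (s : cyc_shift) u w :
  pres_eq triangle_relators u w ->
  pres_eq triangle_relators (word_map (sgval s) u) (word_map (sgval s) w).
Proof.
elim=> [a|a b _|a b c _ ab _ bc|x b a c|r a c].
- exact: pres_refl.
- exact: pres_sym.
- exact: pres_trans ab bc.
- by rewrite /word_map !map_cat; exact: pres_cancel.
- case=> i [j [k [ijk ->]]]; rewrite /word_map !map_cat /=.
  apply: (@pres_relator _ _ [:: _; _; _]).
  by exists (sgval s i), (sgval s j), (sgval s k); split=> //; exact: triples_shift.
Qed.

Definition shift_fun (s : cyc_shift) (g : GammaT) : GammaT :=
  pclass triangle_relators (word_map (sgval s) (prepr g)).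

Lemma shift_fun_class s w :
  shift_fun s (pclass _ w) = pclass _ (word_map (sgval s) w).
Proof. by apply/pclassP/word_map_eq; exact: prepr_class. Qed.

Lemma shift_fun1 g : shift_fun 1 g = g.
Proof.
rewrite -[g]preprK shift_fun_class; congr pclass.
by rewrite -[RHS]map_id; apply: eq_map => -[x b]; rewrite /= perm1.
Qed.

(* Permutations compose left to right in [{perm _}]; since the cyclic group
   <[shift]> is commutative this does not affect the action. *)
Lemma shift_funM s t g : shift_fun (s * t) g = shift_fun s (shift_fun t g).
Proof.
rewrite -[g]preprK !shift_fun_class; congr pclass.
rewrite /word_map -map_comp; apply: eq_map => -[x b] /=; congr (_, _).
rewrite permM (cyc_shiftE t (sgval s x)) (cyc_shiftE s x) (cyc_shiftE t x).
by rewrite (cyc_shiftE s (_ + _)%R) -!addrA [(sgval s _ + _)%R]addrC.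
Qed.

Lemma shift_fun_morph s : {morph shift_fun s : g h / g * h}.
Proof.
move=> g h; rewrite -[g]preprK -[h]preprK -pclassM !shift_fun_class.
by rewrite /word_map map_cat pclassM.
Qed.

Definition shift_action : gaction cyc_shift GammaT :=
  GAction shift_fun1 shift_funM shift_fun_morph.

Definition GammaTp : groupType := semidirect_type shift_action.

Definition inT (g : GammaT) : GammaTp := @sd_inl _ _ shift_action g.

Definition p_ : GammaTp := @sd_inr _ _ shift_action (subg <[shift]> shift).

Lemma p_conj i : p_ * inT (a_ i) * p_^-1 = inT (a_ (i + 1)%R).
Proof.
apply: (canLR (mulgK _)); congr (_, _); last by rewrite /= mulg1 mul1g.
rewrite /= mul1g shift_fun1 mulg1 shift_fun_class /= subgK ?cycle_id //.
by rewrite permE.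
Qed.

Definition sigma0 : GammaTp := p_.
Definition sigma1 (i : 'Z_v) : GammaTp := inT (a_ i) * p_ * (inT (a_ i))^-1.
Definition sigma2 (k : 'Z_v) : GammaTp := (inT (a_ k))^-1 * p_ * inT (a_ k).

Definition GammaA (i k : 'Z_v) : set GammaTp :=
  generated [set sigma0; sigma1 i; sigma2 k].

Definition GammaR : set GammaT :=
  generated [set b | exists i j, i != j /\ b = a_ i * (a_ j)^-1].

Lemma phi_exists i k : exists phi : GammaTp -> 'Z_v,
  {in GammaA i k &, {morph phi : x y / x * y >-> (x + y)%R}} /\
  [/\ phi sigma0 = 1%R, phi (sigma1 i) = 1%R & phi (sigma2 k) = 1%R].
Proof.
pose phi (x : GammaTp) : 'Z_v := sgval x.2 0%R.
have phiM x y : phi (x * y) = (phi x + phi y)%R.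
  by rewrite /phi /= permM cyc_shiftE.
have phi1 g : phi (inT g) = 0%R by rewrite /phi /= perm1.
have phiV g : phi (inT g)^-1 = 0%R by rewrite /phi /= invg1 perm1.
have phip : phi p_ = 1%R.
  by rewrite /phi /= subgK ?cycle_id // permE /= add0r.
exists phi; split=> [x y _ _|]; first by rewrite phiM.
rewrite /sigma1 /sigma2 /sigma0 !phiM !phi1 !phiV phip addr0 add0r.
by split; rewrite ?addr0.
Qed.

Lemma psi_exists : exists psi : GammaT -> 'Z_3,
  {morph psi : x y / x * y >-> (x + y)%R} /\ forall i, psi (a_ i) = 1%R.
Proof.
pose val (w : word 'Z_v) : 'Z_3 := (\sum_(l <- w) (-1) ^+ l.2)%R.
have val_cat u w : val (u ++ w) = (val u + val w)%R by rewrite /val big_cat.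
have val_eq u w : pres_eq triangle_relators u w -> val u = val w.
  elim=> [//|a b _ -> //|a b c _ -> _ -> //|x b a c|r a c].
    rewrite !val_cat; congr (_ + _)%R.
    by rewrite /val !big_cons big_nil; case: b; rewrite addr0 ?addNr ?addrN add0r.
  case=> i [j [l [_ ->]]]; rewrite !val_cat; congr (_ + _)%R.
  by rewrite /val !big_cons big_nil -[RHS]add0r; congr (_ + _)%R; apply/val_inj.
exists (fun g => val (prepr g)); split=> [g h|i].
  by rewrite -val_cat; apply: val_eq; exact: prepr_class.
by rewrite (val_eq _ _ (prepr_class _ _)) /val big_seq1.
Qed.

End SingerCyclic.

Arguments a_ {v} D m i.
Arguments p_ {v} D m.
Arguments sigma0 {v} D m.
Arguments sigma1 {v} D m i.
Arguments sigma2 {v} D m k.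
Arguments GammaA {v} D m i k _.
Arguments GammaR {v} D m _.

(* Main.v *)
(** Modulo [GammaR] all generators coincide on one side.  Two points [l], [i]
    of the plane lie on a common line [s + D], so there are relators
    [a_s a_l a_n] and [a_s a_i a_t], whence [a_l^-1 a_i = a_n a_t^-1].  Hence
    [GammaR] is normal, the quotient is generated by a single class whose cube
    is trivial, and [GammaR] is the kernel of [psi].  On the other side
    [sigma1 i * p^-1 = a_i a_(i+1)^-1]; conjugating by powers of [p] and
    telescoping puts every [a_i a_j^-1] in [GammaA], while every generator of
    [GammaA] has first component in the kernel of [psi] and second component
    the shift by its value under [phi]. *)
Require Import Defs.
From mathcomp Require Import all_boot all_order all_algebra all_fingroup.
From mathcomp Require Import boolp classical_sets.
Local Open Scope classical_set_scope.
Import GRing.Theory.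
Local Open Scope ring_scope.

Set Implicit Arguments.
Unset Strict Implicit.

(** * Generated subgroups and induction in presented groups *)

Section Subgroups.
Local Open Scope group_scope.

Section Closure.
Context {G : groupType} {H : set G} (sgH : is_subgroup H).

Lemma subgroupV x : H x -> H x^-1.
Proof. by case: sgH => H1 HM Hx; rewrite -[x^-1]mul1g; apply: HM. Qed.

Lemma subgroupM x y : H x -> H y -> H (x * y).
Proof.
by case: (sgH) => _ HM Hx Hy; rewrite -[y]invgK; apply: HM => //; apply: subgroupV.
Qed.

End Closure.

Lemma generated_subgroup (G : groupType) (A : set G) : is_subgroup (Defs.generated A).
Proof.
split=> [H [[]] //|x y Ax Ay H HA].
by case: (HA) => -[_ HM] _; apply: HM; [apply: Ax | apply: Ay].
Qed.

Lemma generated_sub (G : groupType) (A H : set G) :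
  is_subgroup H -> A `<=` H -> Defs.generated A `<=` H.
Proof. exact: smallest_sub. Qed.

Lemma mem_generated (G : groupType) (A : set G) : A `<=` Defs.generated A.
Proof. by move=> x Ax H [_]; apply. Qed.

(** Induction on the length of a representing word, peeling off its first letter; the letter
    [(x, true)] is identified with the inverse of [pgen R x] by one cancellation. *)
Lemma presGroup_ind (X : choiceType) (R : set (word X)) (P : presGroup R -> Prop) :
    P 1 -> (forall x g, P g -> P (pgen R x * g)) ->
    (forall x g, P g -> P ((pgen R x)^-1 * g)) ->
  forall g, P g.
Proof.
move=> P1 PM PV g; rewrite -[g]preprK; elim: (prepr g) => [|[x b] w IHw] //.
rewrite -cat1s pclassM; case: b; last exact: PM.
suff -> : pclass R [:: (x, true)] = (pgen R x)^-1 by apply: PV.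
apply: (mulIg (pgen R x)); rewrite mulVg -pclassM.
by apply/pclassP; apply: (pres_cancel _ x true [::] [::]).
Qed.

End Subgroups.

Section GroupToZmod.
Variables (G : groupType) (V : zmodType) (f : G -> V).
Hypothesis fM : {morph f : x y / (x * y)%g >-> x + y}.

Lemma morph_group_zmod1 : f 1%g = 0.
Proof. by apply: (addrI (f 1%g)); rewrite -fM mulg1 addr0. Qed.

Lemma morph_group_zmodV x : f x^-1%g = - f x.
Proof. by apply: (addrI (f x)); rewrite -fM mulgV morph_group_zmod1 subrr. Qed.

End GroupToZmod.

(** * Incidence in the plane of the difference set *)

(** For distinct points, [l - i] is a difference [d - d'] of elements of [D], and [s = l - d] works;
    for equal points any element of [D] does. *)
Lemma perfect_difference_common_line {q v : nat} {D : {set 'Z_v}} :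
    perfect_difference_set q D ->
  forall l i : 'Z_v, exists s d d',
    [/\ d \in D, d' \in D, l = s + d & i = s + d'].
Proof.
case=> cardD diffD l i; have [->|neq_li] := eqVneq l i.
  have /card_gt0P[d Dd] : (0 < #|D|)%N by rewrite cardD.
  by exists (i - d), d, d; rewrite subrK.
have /diffD card1 : l - i != 0 by rewrite subr_eq0.
have /card_gt0P[[d d']] := eq_leq (esym card1).
rewrite !inE /= => /andP[/andP[Dd Dd']] /eqP ddE.
exists (l - d), d, d'; rewrite subrK; split=> //.
by rewrite -addrA [_ + d']addrC -opprB ddE opprB addrC subrK.
Qed.

(** * Normality and cosets of [GammaR] *)

Section SingerCyclicLattice.
Variables (q v : nat) (D : {set 'Z_v}) (m : nat).
Hypothesis hD : perfect_difference_set q D.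

Local Notation a := (a_ D m).
Local Notation R := (GammaR D m).

Lemma triple_relation i d :
  d \in D -> (a i * a (i + d) * a (i + d + m%:R * d) = 1)%g.
Proof.
move=> Dd; suff: pclass (triangle_relators D m) ([:: (i, false)] ++ [:: (i + d, false)]
    ++ [:: (i + d + m%:R * d, false)]) = 1%g by rewrite !pclassM mulgA.
apply/pclassP.
apply: (@pres_relator _ _ [:: _; _; _] [::] [::]).
by exists i, (i + d), (i + d + m%:R * d); split=> //; apply/imset2P; exists i d.
Qed.

Let sgR : is_subgroup R. Proof. exact: generated_subgroup. Qed.

Lemma GammaR_mulV i j : R (a i * (a j)^-1)%g.
Proof.
have [->|neq_ij] := eqVneq i j; first by rewrite mulgV; case: sgR.
by apply: mem_generated; exists i, j.
Qed.

Lemma GammaR_Vmul i j : R ((a i)^-1 * a j)%g.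
Proof.
have [s [d [d' [Dd Dd' -> ->]]]] := perfect_difference_common_line hD i j.
(* Both points lie on the line of [s], so both generators start with the same factor [(a s)^-1],
   which cancels in the quotient. *)
have aE e : e \in D -> a (s + e) = ((a s)^-1 * (a (s + e + m%:R * e)%R)^-1)%g.
  by move=> De; apply/(mulgI (a s))/(mulIg (a (s + e + m%:R * e)%R));
     rewrite triple_relation // mulKVg mulVg.
by rewrite (aE _ Dd) (aE _ Dd') invMg !invgK -mulgA mulKVg; apply: GammaR_mulV.
Qed.

(** The elements with conjugate in [R] form a subgroup, so generators suffice; there the conjugate
    splits into two factors covered by [GammaR_Vmul]. *)
Lemma GammaR_conjV l g : R g -> R ((a l)^-1 * g * a l)%g.
Proof.
move: g; apply: generated_sub => [|_ [i [j [_ ->]]]].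
  split=> [|x y Rx Ry]; first by rewrite mulg1 mulVg; case: sgR.
  have -> : ((a l)^-1 * (x * y^-1) * a l
      = ((a l)^-1 * x * a l) * ((a l)^-1 * y * a l)^-1)%g.
    by rewrite !invMg invgK !mulgA mulgK.
  by case: sgR => _; apply.
have -> : ((a l)^-1 * (a i * (a j)^-1) * a l
    = ((a l)^-1 * a i) * ((a j)^-1 * a l))%g by rewrite !mulgA.
by apply: (subgroupM sgR); apply: GammaR_Vmul.
Qed.

Lemma GammaR_conj l g : R g -> R (a l * g * (a l)^-1)%g.
Proof.
move: g; apply: generated_sub => [|_ [i [j [_ ->]]]].
  split=> [|x y Rx Ry]; first by rewrite mulg1 mulgV; case: sgR.
  have -> : (a l * (x * y^-1) * (a l)^-1
      = (a l * x * (a l)^-1) * (a l * y * (a l)^-1)^-1)%g.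
    by rewrite !invMg invgK !mulgA mulgKV.
  by case: sgR => _; apply.
have [s [d [d' [Dd Dd' -> ->]]]] := perfect_difference_common_line hD i j.
have aE e : e \in D -> (a s * a (s + e)%R = (a (s + e + m%:R * e)%R)^-1)%g.
  by move=> De; apply/(mulIg (a (s + e + m%:R * e)%R)); rewrite triple_relation // mulVg.
(* Inserting [a s] turns the middle factor into a quotient of two products [a s * a (s + e)], each
   the inverse of a generator by its relator. *)
have -> : (a l * (a (s + d)%R * (a (s + d')%R)^-1) * (a l)^-1
    = a l * (a s)^-1 * ((a s * a (s + d)%R) * (a s * a (s + d')%R)^-1)
      * (a s * (a l)^-1))%g by rewrite invMg !mulgA !mulgKV.
rewrite (aE _ Dd) (aE _ Dd') invgK.
apply: (subgroupM sgR); last exact: GammaR_mulV.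
by apply: (subgroupM sgR); [apply: GammaR_mulV | apply: GammaR_Vmul].
Qed.

Lemma GammaR_cube : R (a 0 ^+ 3)%g.
Proof.
have [s [d [_ [Dd _ _ _]]]] := perfect_difference_common_line hD 0 0.
have tV : ((a (s + d + m%:R * d)%R)^-1 = a s * a (s + d)%R)%g.
  by apply/(mulIg (a (s + d + m%:R * d)%R)); rewrite triple_relation // mulVg.
(* Compares the cube with the relator on [s], [s + d], [s + d + m%:R * d], replacing one letter at a
   time. *)
have eq3 : (a 0 ^+ 3 = (a 0 * (a s)^-1)
    * (a s * (a 0 * (a (s + d)%R)^-1) * (a s)^-1)
    * ((a (s + d + m%:R * d)%R)^-1 * a 0))%g.
  by rewrite tV !expgS expg0 mulg1 !mulgA !mulgKV.
rewrite eq3; apply: (subgroupM sgR); last exact: GammaR_Vmul.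
apply: (subgroupM sgR); first exact: GammaR_mulV.
by apply: GammaR_conj; apply: GammaR_mulV.
Qed.

Lemma GammaR_coset g : exists n r, R r /\ (g = r * a 0 ^+ n)%g.
Proof.
elim/presGroup_ind: g => [|x g [n [r [Rr ->]]]|x g [n [r [Rr ->]]]].
- by exists 0%N, 1%g; rewrite expg0 mulg1; split=> //; case: sgR.
- exists n.+1, ((a x * (a 0)^-1) * (a 0 * r * (a 0)^-1))%g.
  split; last by rewrite expgS !mulgA !mulgKV.
  by apply: (subgroupM sgR); [apply: GammaR_mulV | apply: GammaR_conj].
(* The exponent stays a natural number: modulo the cube, the inverse of [a 0] is its square. *)
- exists n.+2, (((a x)^-1 * r * a x) * ((a x)^-1 * a 0) * (a 0 ^+ 3)^-1)%g.
  split.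
    apply: (subgroupM sgR); last exact: (subgroupV sgR GammaR_cube).
    exact: (subgroupM sgR (GammaR_conjV x Rr) (GammaR_Vmul x 0)).
  by rewrite !expgS expg0 mulg1 !invMg !mulgA !mulgK !mulgKV.
Qed.

(** * The kernel of [psi] *)

Section Kernel.
Variable psi : GammaT D m -> 'Z_3.
Hypothesis psiM : {morph psi : x y / (x * y)%g >-> x + y}.
Hypothesis psi_a : forall l, psi (a l) = 1.

Let psi1 := morph_group_zmod1 psiM.
Let psiV := morph_group_zmodV psiM.

Lemma psi_kernel : [set g | psi g = 0] = R.
Proof.
have psi_R : R `<=` [set g | psi g = 0].
  apply: generated_sub => [|_ [i [j [_ ->]]]] /=.
    by split=> // x y /= psi_x psi_y; rewrite psiM psiV psi_x psi_y subr0.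
  by rewrite psiM psiV !psi_a subrr.
apply/seteqP; split=> // g /= psi_g.
have [n [r [Rr gE]]] := GammaR_coset g.
have psiX e : psi (a 0 ^+ e)%g = e%:R.
  by elim: e => [|e IHe]; rewrite ?expg0 ?psi1 // expgS psiM psi_a IHe -natr1 addrC.
(* Since [psi] sends [r * a 0 ^+ n] to [n] modulo 3, the exponent is a multiple of 3 and
   [GammaR_cube] applies. *)
move: psi_g; rewrite gE psiM (psi_R _ Rr) add0r psiX => /(congr1 val).
rewrite /= val_Zp_nat // => /eqP/dvdnP[e ->].
rewrite mulnC expgM; apply: (subgroupM sgR) => //.
elim: e => [|e IHe]; first by case: sgR.
by rewrite expgS; apply: (subgroupM sgR) => //; apply: GammaR_cube.
Qed.

(** A shift permutes the generators, on all of which [psi] is 1. This removes the twist from first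
    components of products in the semidirect product. *)
Lemma psi_shift s g : psi (shift_fun s g) = psi g.
Proof.
have sM := shift_fun_morph (D := D) (m := m) s.
have s1 : shift_fun s (1 : GammaT D m)%g = 1%g.
  by apply: (mulgI (shift_fun s 1)%g); rewrite -sM !mulg1.
have sa x : shift_fun s (a x) = a (sgval s x) by rewrite shift_fun_class.
have sV x : shift_fun s (x^-1 : GammaT D m)%g = (shift_fun s x)^-1%g.
  by apply: (mulgI (shift_fun s x)); rewrite -sM !mulgV.
elim/presGroup_ind: g => [|x g IHg|x g IHg]; first by rewrite s1.
  by rewrite sM !psiM IHg -/(a x) sa !psi_a.
by rewrite sM sV !psiM IHg -/(a x) sa !psiV !psi_a.
Qed.

End Kernel.

(** * Embedding [GammaR] into the Singer cyclic lattice *)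

Lemma cyc_shift_eq1 (s : cyc_shift v) : sgval s 0 = 0 -> s = 1%g.
Proof.
by move=> s0; apply/val_inj/permP => x; rewrite /= cyc_shiftE s0 addr0 perm1.
Qed.

Lemma inTM : {morph @inT v D m : g h / (g * h)%g}.
Proof. by move=> g h; congr (_, _); rewrite /= ?shift_fun1 ?mulg1. Qed.

Lemma inT1 : @inT v D m 1%g = 1%g. Proof. by []. Qed.

Lemma inTV : {morph @inT v D m : g / g^-1%g}.
Proof. by move=> g; apply: (mulgI (inT g)); rewrite -inTM !mulgV. Qed.

Variables (i k : 'Z_v).
Local Notation A := (GammaA D m i k).

Let sgA : is_subgroup A. Proof. exact: generated_subgroup. Qed.

Let Ap : A (p_ D m). Proof. by apply: mem_generated; left; left. Qed.

Lemma GammaA_step l : A (inT (a l * (a (l + 1))^-1)%g).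
Proof.
have [n ->] : exists n : nat, l = i + n%:R.
  by exists (l - i : 'Z_v); rewrite natr_Zp addrC subrK.
elim: n => [|n IHn].
  (* The base case is [sigma1 i] times the inverse of [p_]. *)
  rewrite addr0 inTM inTV -p_conj !invMg invgK !mulgA.
  apply: (subgroupM sgA); last exact: (subgroupV sgA).
  by apply: mem_generated; left; right.
(* Conjugation by [p_] raises both indices by one. *)
have -> : inT (a (i + n.+1%:R) * (a (i + n.+1%:R + 1))^-1)%g
    = (p_ D m * inT (a (i + n%:R) * (a (i + n%:R + 1))^-1)%g * (p_ D m)^-1)%g.
  rewrite -natr1 addrA !inTM !inTV -!p_conj !invMg !invgK !mulgA.
  by rewrite mulgKV.
by apply: (subgroupM sgA); [apply: (subgroupM sgA) | apply: (subgroupV sgA)].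
Qed.

Lemma GammaR_sub_GammaA g : R g -> A (inT g).
Proof.
move: g; apply: (@generated_sub _ _ [set g | A (inT g)]).
  split=> [|x y Ax Ay] /=; first by rewrite inT1; case: sgA.
  by rewrite inTM inTV; case: sgA => _; apply.
move=> _ [x [y [_ ->]]] /=.
have [n ->] : exists n : nat, y = x + n%:R.
  by exists (y - x : 'Z_v); rewrite natr_Zp addrC subrK.
elim: n => [|n IHn]; first by rewrite addr0 mulgV inT1; case: sgA.
have -> : (a x * (a (x + n.+1%:R))^-1 = a x * (a (x + n%:R))^-1
    * (a (x + n%:R) * (a (x + n%:R + 1))^-1))%g.
  by rewrite -natr1 addrA !mulgA mulgKV.
by rewrite inTM; apply: (subgroupM sgA) => //; apply: GammaA_step.
Qed.

(** * The kernel of [phi] *)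

Variable phi : GammaTp D m -> 'Z_v.
Hypothesis phiM : {in A &, {morph phi : x y / (x * y)%g >-> x + y}}.
Hypothesis phi0 : phi (sigma0 D m) = 1.
Hypothesis phi1 : phi (sigma1 D m i) = 1.
Hypothesis phi2 : phi (sigma2 D m k) = 1.
Variable psi : GammaT D m -> 'Z_3.
Hypothesis psiM : {morph psi : x y / (x * y)%g >-> x + y}.
Hypothesis psi_a : forall l, psi (a l) = 1.

Let psi1 := morph_group_zmod1 psiM.
Let psiV := morph_group_zmodV psiM.

Lemma GammaA_components x : A x -> phi x = sgval x.2 0 /\ psi x.1 = 0.
Proof.
(* As [phi] is multiplicative only on [A], membership in [A] is carried along to make this set a
   subgroup. *)
pose H := [set x | A x /\ (phi x = sgval x.2 0 /\ psi x.1 = 0)].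
suff AH : A `<=` H by case/AH.
have phi_1 : phi 1%g = 0.
  apply: (addrI (phi 1%g)); rewrite -phiM ?mulg1 ?addr0 //;
  by apply/mem_set; case: sgA.
have phiV y : A y -> phi y^-1%g = - phi y.
  move=> Ay; apply: (addrI (phi y)).
  rewrite -phiM ?mulgV ?phi_1 ?subrr //; apply/mem_set => //.
  exact: (subgroupV sgA).
have val2M (y z : GammaTp D m) : sgval (y * z)%g.2 0 = sgval y.2 0 + sgval z.2 0.
  by rewrite /= permM cyc_shiftE.
have val2V (y : GammaTp D m) : sgval y^-1%g.2 0 = - sgval y.2 0.
  by apply: (addrI (sgval y.2 0)); rewrite -val2M mulgV /= perm1 subrr.
have val2T (g : GammaT D m) : sgval (inT g).2 0 = 0 by rewrite /= perm1.
have val2p : sgval (p_ D m).2 0 = 1.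
  by rewrite /= subgK ?cycle_id // permE add0r.
have psi1M (y z : GammaTp D m) : psi (y * z)%g.1 = psi y.1 + psi z.1.
  by rewrite /= psiM psi_shift.
have psi1V (y : GammaTp D m) : psi y^-1%g.1 = - psi y.1.
  by rewrite /= psi_shift.
apply: generated_sub => {x} [|x].
  split=> [|y z [Ay [phi_y psi_y]] [Az [phi_z psi_z]]].
    by do 2?split; [case: sgA | rewrite phi_1 /= perm1 | rewrite /= psi1].
  have AVz : A z^-1%g by apply: (subgroupV sgA).
  split; first exact: (subgroupM sgA).
  rewrite phiM ?phiV ?val2M ?val2V ?psi1M ?psi1V ?phi_y ?phi_z ?psi_y ?psi_z ?subr0 //;
  exact/mem_set.
move=> Sx; split; first exact: mem_generated.
case: Sx => [[|]|] ->.
- by rewrite phi0 val2p /= psi1.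
- by rewrite phi1 !val2M !psi1M val2V psi1V !val2T val2p add0r subr0 /= psi1 addr0 subrr.
- by rewrite phi2 !val2M !psi1M val2V psi1V !val2T val2p addr0 oppr0 add0r /= psi1 addr0 addNr.
Qed.

Lemma phi_kernel : [set x | x \in A /\ phi x = 0] = [set inT g | g in R].
Proof.
apply/seteqP; split=> [x /= [/set_mem Ax]|_ [g Rg <-]].
  (* The value of [phi] is the amount of the shift, so vanishing makes the second component trivial
     and leaves [x] in the image of [inT]. *)
  have [-> psi_x] := GammaA_components Ax => /cyc_shift_eq1 x2.
  exists x.1; last by move: x2; rewrite /inT /sd_inl; case: x {Ax psi_x} => ? ? /= ->.
  by rewrite -(psi_kernel psiM psi_a).
have Ag := GammaR_sub_GammaA Rg; split; first exact/mem_set.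
by have [-> _] := GammaA_components Ag; rewrite /= perm1.
Qed.

End SingerCyclicLattice.

Unset Implicit Arguments.

Theorem theorem3p16 (q v : nat)
    (hq : exists r n : nat, [/\ prime r, (0 < n)%N & q = (r ^ n)%N])
    (hv : v = (q ^ 2 + q + 1)%N)
    (D : {set 'Z_v}) (hD : perfect_difference_set q D)
    (hqD : [set q%:R * d | d in D]%SET = D)
    (m : nat) (hm : m = q \/ m = (q ^ 2)%N)
    (i j k : 'Z_v) (hijk : (i, j, k) \in triples D m)
    (phi : GammaTp D m -> 'Z_v)
    (hphi : {in GammaA D m i k &,
              {morph phi : x y / (x * y)%g >-> x + y}})
    (hphi0 : phi (sigma0 D m) = 1)
    (hphi1 : phi (sigma1 D m i) = 1)
    (hphi2 : phi (sigma2 D m k) = 1)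
    (psi : GammaT D m -> 'Z_3)
    (hpsi : {morph psi : x y / (x * y)%g >-> x + y})
    (hpsia : forall l : 'Z_v, psi (a_ D m l) = 1) :
  [set x | x \in GammaA D m i k /\ phi x = 0]
    = [set inT g | g in [set g : GammaT D m | psi g = 0]]
  /\ [set inT g | g in [set g : GammaT D m | psi g = 0]]
    = [set inT g | g in GammaR D m].
Proof.
by rewrite (phi_kernel hD hphi hphi0 hphi1 hphi2 hpsi hpsia) (psi_kernel hD hpsi hpsia).
Qed.
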